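(* Let $r\in\mathbb{N}$, let $G=(g_1,\ldots,g_r)$ be any system of polynomials with integer coefficients, let $m_1,\ldots,m_r\in\mathbb{N}$ and $m=\operatorname{lcm}(m_1,\ldots,m_r)$. Define $$R_G(m_1,\ldots,m_r)=\sum_{\substack{k=1\\ \gcd(k,m)=1}}^m c_{m_1}(g_1(k))\cdots c_{m_r}(g_r(k)).$$ Then $$R_G(m_1,\ldots,m_r)=\phi(m)\sum_{d_1\mid m_1,\ldots,d_r\mid m_r}\frac{d_1\mu(m_1/d_1)\cdots d_r\mu(m_r/d_r)}{\phi(\operatorname{lcm}(d_1,\ldots,d_r))}\,\eta_G(d_1,\ldots,d_r).$$
   Context: For $n\in\mathbb{N}$ and $k\in\mathbb{Z}$, $c_n(k)=\sum_{1\le j\le n,\ \gcd(j,n)=1}\exp(2\pi i jk/n)$ is the Ramanujan sum. $\mu$ is the Möbius function and $\phi$ is Euler's totient function. For $d_1,\ldots,d_r\in\mathbb{N}$, $\eta_G(d_1,\ldots,d_r)$ denotes the number of residues $x$ modulo $\operatorname{lcm}(d_1,\ldots,d_r)$ satisfying simultaneously $g_1(x)\equiv 0 \pmod{d_1},\ldots,g_r(x)\equiv 0\pmod{d_r}$ and $\gcd(x,d_1)=\cdots=\gcd(x,d_r)=1$. *)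

(* Defs.v *)
From HB Require Import structures.
From mathcomp Require Import all_boot all_order all_algebra.
From mathcomp Require Import complex.
From mathcomp Require Import reals sequences exp trigo.

Set Implicit Arguments.
Unset Strict Implicit.
Unset Printing Implicit Defensive.
Import Order.TTheory GRing.Theory Num.Theory.
Local Open Scope ring_scope.

(* exp (x + iy) = e^x (cos y + i sin y) *)
Definition cexp (R : realType) (z : R[i]) : R[i] :=
  (expR (complex.Re z))%:C%C * (cos (complex.Im z) +i* sin (complex.Im z))%C.

Definition ramanujan_sum (R : realType) (n : nat) (k : int) : R[i] :=
  \sum_(1 <= j < n.+1 | coprime j n)
     cexp (2 * (pi : R)%:C%C * 'i%C * j%:R * k%:~R / n%:R).

(* Only meaningful for n > 0 (the value at 0 is junk). *)
Definition mobius (n : nat) : int :=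
  if has (fun p => p ^ 2 %| n)%N (primes n) then 0
  else (-1) ^+ size (primes n).

Definition lcm_family (r : nat) (d : 'I_r -> nat) : nat :=
  \big[lcmn/1%N]_(i < r) d i.

(* Residues modulo L = lcm(d_1, ..., d_r) are represented by 0, ..., L - 1;
   both conditions depend only on x modulo L. *)
Definition eta (r : nat) (g : 'I_r -> {poly int}) (d : 'I_r -> nat) : nat :=
  #|[set x : 'I_(lcm_family d) |
      [forall i, ((d i)%:Z %| (g i).[x%:Z])%Z && coprime x (d i)]]|.

Definition R_G (R : realType) (r : nat) (g : 'I_r -> {poly int})
    (m : 'I_r -> nat) : R[i] :=
  \sum_(1 <= k < (lcm_family m).+1 | coprime k (lcm_family m))
     \prod_(i < r) ramanujan_sum R (m i) (g i).[k%:Z].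

(* Main.v *)
Require Import Defs.
From mathcomp Require Import all_boot all_order all_algebra complex reals.
From mathcomp Require Import cyclic exp trigo zify ring lra.
Import GRing.Theory Num.Theory.
Local Open Scope ring_scope.

(** Writing the indicator of coprimality as a Möbius sum and summing roots of
    unity gives c_n(k) = sum of d mu(n/d) over d | gcd(n, k).  Expanding the
    product of Ramanujan sums and exchanging summations, it remains to count the
    units k modulo m with d_i | g_i(k) for all i.  This condition depends only on
    k modulo L = lcm(d_1, ..., d_r), and the reduction map from the units modulo
    m to the units modulo L is onto with fibers of equal size phi(m) / phi(L),
    so the count is phi(m) / phi(L) * eta_G(d_1, ..., d_r). *)

(** * Reindexing sums over divisors and multiples *)

(** One bound [M] serves the divisors of every [m i], so a product of divisor sums can be
    distributed over functions into a single ordinal type. *)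
Lemma big_divisors_ord (V : nmodType) (n M : nat) (P : pred nat) (F : nat -> V) :
  (0 < n <= M)%N ->
  \sum_(d <- divisors n | P d) F d =
  \sum_(d < M.+1 | (d %| n)%N && P d) F d.
Proof.
case/andP=> n0 nM.
rewrite -(big_mkord (fun d => (d %| n)%N && P d)) -[LHS]big_filter -[RHS]big_filter.
apply: perm_big; apply: uniq_perm; rewrite ?filter_uniq ?divisors_uniq ?iota_uniq //.
move=> d; rewrite !mem_filter mem_index_iota -dvdn_divisors //.
by case: (boolP (d %| n)%N) => [/(dvdn_leq n0)|]; rewrite ?andbF //=; lia.
Qed.

Lemma divn_compl (n d : nat) : (0 < n)%N -> (d %| n)%N -> (n %/ (n %/ d))%N = d.
Proof.
move=> n0 dn; rewrite -{1}(divnK dn) mulKn //.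
by rewrite divn_gt0 ?(dvdn_leq n0 dn) // (dvdn_gt0 n0 dn).
Qed.

Lemma dvdn_compl (n d : nat) : (d %| n)%N -> (n %/ d %| n)%N.
Proof. by move=> dn; rewrite -{2}(divnK dn) dvdn_mulr. Qed.

Lemma big_divisors_compl (V : nmodType) (n : nat) (P : pred nat) (F : nat -> V) :
  (0 < n)%N ->
  \sum_(d <- divisors n | P d) F d =
  \sum_(d <- divisors n | P (n %/ d)%N) F (n %/ d)%N.
Proof.
move=> n0; rewrite -(big_map (fun d => n %/ d)%N P F).
have inv d : (d %| n)%N -> (n %/ (n %/ d))%N = d := divn_compl _ _ n0.
have dvd d : (d %| n)%N -> (n %/ d %| n)%N := dvdn_compl _ _.
apply: perm_big; apply: uniq_perm; rewrite ?divisors_uniq //.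
  rewrite map_inj_in_uniq ?divisors_uniq // => a b.
  rewrite -!dvdn_divisors // => /inv {2}<- /inv {2}<- -> //.
move=> d; apply/idP/mapP => [|[e]]; rewrite -!dvdn_divisors //.
  by move=> dn; exists (n %/ d)%N; rewrite -?dvdn_divisors ?inv ?dvd.
by move=> en ->; apply: dvd.
Qed.

Lemma big_nat_dvdn (V : nmodType) (n e : nat) (F : nat -> V) : (0 < e)%N ->
  \sum_(1 <= j < n.+1 | (e %| j)%N) F j =
  \sum_(1 <= j < (n %/ e).+1) F (e * j)%N.
Proof.
move=> e0; rewrite -big_filter -(big_map (muln e) predT F).
apply: perm_big; apply: uniq_perm.
- by rewrite filter_uniq ?iota_uniq.
- rewrite map_inj_uniq ?iota_uniq // => a b /eqP.
  by rewrite eqn_pmul2l // => /eqP.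
move=> j; rewrite mem_filter mem_index_iota; apply/andP/mapP.
  case=> /dvdnP[k ->]; rewrite !ltnS => /andP[k0 kn].
  exists k; last by rewrite mulnC.
  by rewrite mem_index_iota ltnS leq_divRL // kn; case: k k0 {kn}.
case=> k; rewrite mem_index_iota !ltnS => /andP[k0]; rewrite leq_divRL // => kn ->.
by rewrite dvdn_mulr // muln_gt0 e0 k0 mulnC.
Qed.

(** * Möbius inversion for the coprimality indicator *)

(** If [p] does not divide [e], passing to [p * e] adds one prime and no new square factor, so only
    the sign changes; otherwise [p ^ 2] divides [p * e]. *)
Lemma mobius_prime_mul (p e : nat) : prime p -> (0 < e)%N ->
  mobius (p * e) = if (p %| e)%N then 0 else - mobius e.
Proof.
move=> pp e0; have p0 := prime_gt0 pp.
have mem q : (q \in primes (p * e)) = (q == p) || (q \in primes e).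
  by rewrite primesM // (primes_prime pp) inE.
rewrite /mobius; case: (boolP (p %| e)%N) => pe.
  rewrite ifT //; apply/hasP; exists p; first by rewrite mem eqxx.
  by rewrite expnS expn1 dvdn_pmul2l.
have perm : perm_eq (primes (p * e)) (p :: primes e).
  apply: uniq_perm; rewrite ?primes_uniq //= ?primes_uniq.
  by rewrite mem_primes (negPf pe) !andbF.
rewrite (perm_size perm) (perm_has _ perm) /= exprS mulN1r.
have -> : (p ^ 2 %| p * e)%N = false by rewrite expnS expn1 dvdn_pmul2l // (negPf pe).
rewrite /= (@eq_in_has _ _ (fun q => q ^ 2 %| e)%N).
  by case: ifP; rewrite ?oppr0.
move=> q; rewrite mem_primes => /and3P[pq _ qe]; rewrite Gauss_dvdr //.
rewrite coprimeXl // prime_coprime // dvdn_prime2 //.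
by apply: contraNneq pe => <-.
Qed.

(** For a prime [p] dividing [n], both the divisors [p * e] of [n] and those prime to [p] are
    indexed by divisors [e] of [n %/ p]. The terms for [e] and [p * e] cancel when [p] does not
    divide [e]; the remaining terms [p * e] vanish. *)
Lemma sum_mobius (n : nat) : (0 < n)%N ->
  \sum_(e <- divisors n) mobius e = (n == 1%N)%:R.
Proof.
move=> n0; case: (eqVneq n 1%N) => [->|n1]; first by rewrite big_seq1.
have /pdivP[p pp pn] : (1 < n)%N by lia.
have p0 := prime_gt0 pp.
have np0 : (0 < n %/ p)%N by rewrite divn_gt0 // dvdn_leq.
rewrite (bigID (fun e => p %| e)%N) /=.
have -> : \sum_(e <- divisors n | (p %| e)%N) mobius e =
   \sum_(e <- divisors (n %/ p)) mobius (p * e).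
  rewrite -(big_map (muln p) predT) -[LHS]big_filter.
  apply: perm_big; apply: uniq_perm.
  - by rewrite filter_uniq ?divisors_uniq.
  - rewrite map_inj_uniq ?divisors_uniq // => a b /eqP.
    by rewrite eqn_pmul2l // => /eqP.
  move=> d; rewrite mem_filter -dvdn_divisors //; apply/andP/mapP.
    case=> /dvdnP[k ->] kn; exists k; last by rewrite mulnC.
    by rewrite -dvdn_divisors // dvdn_divRL.
  case=> k; rewrite -dvdn_divisors // dvdn_divRL // mulnC => kn ->.
  by rewrite dvdn_mulr.
have -> : \sum_(e <- divisors n | ~~ (p %| e)%N) mobius e =
   \sum_(e <- divisors (n %/ p) | ~~ (p %| e)%N) mobius e.
  rewrite -[LHS]big_filter -[RHS]big_filter.
  apply: perm_big; apply: uniq_perm; rewrite ?filter_uniq ?divisors_uniq //.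
  move=> d; rewrite !mem_filter -!dvdn_divisors //.
  case: (boolP (p %| d)%N) => //= pd.
  by rewrite -{1}(divnK pn) Gauss_dvdl // coprime_sym prime_coprime.
rewrite [X in _ + X]big_mkcond -big_split big1_seq //= => e.
rewrite -dvdn_divisors // => /(dvdn_gt0 np0) e0.
by rewrite mobius_prime_mul //; case: ifP => /= _; rewrite ?addr0 // addNr.
Qed.

Lemma sum_coprime_mobius (R : pzRingType) (n : nat) (F : nat -> R) : (0 < n)%N ->
  \sum_(1 <= j < n.+1 | coprime j n) F j =
  \sum_(e <- divisors n)
    (mobius e)%:~R * \sum_(1 <= j < (n %/ e).+1) F (e * j)%N.
Proof.
move=> n0.
(* This is [sum_mobius] at [gcdn j n], whose divisors are the divisors of [n] that divide [j]. *)
have ind j : (0 < j)%N ->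
  (coprime j n)%:R = \sum_(e <- divisors n | (e %| j)%N) (mobius e)%:~R :> R.
  move=> j0; have g0 : (0 < gcdn j n)%N by rewrite gcdn_gt0 j0.
  have := sum_mobius _ g0; rewrite -/(coprime j n) => /(congr1 (intr : int -> R)).
  rewrite rmorph_sum /= rmorph_nat => <-.
  rewrite -[RHS]big_filter; apply: perm_big.
  apply: uniq_perm; rewrite ?filter_uniq ?divisors_uniq //.
  by move=> d; rewrite mem_filter -!dvdn_divisors // dvdn_gcd.
rewrite big_mkcond big_nat.
transitivity (\sum_(1 <= j < n.+1)
   \sum_(e <- divisors n) (if (e %| j)%N then (mobius e)%:~R * F j else 0)).
  rewrite [RHS]big_nat; apply: eq_bigr => j /andP[j0 _].
  rewrite -big_mkcond -mulr_suml -ind //.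
  by case: coprime; rewrite ?mul1r ?mul0r.
rewrite exchange_big; apply: eq_big_seq => e.
rewrite -dvdn_divisors // => /(dvdn_gt0 n0) e0.
by rewrite -big_nat_dvdn // mulr_sumr -big_mkcond.
Qed.

(** * Reduction of units modulo m to units modulo a divisor L *)

Lemma coprime_lift (m L x : nat) : (0 < m)%N -> (L %| m)%N -> coprime x L ->
  exists2 u, coprime u m & u = x %[mod L].
Proof.
move=> m0 Lm cxL; have L0 := dvdn_gt0 m0 Lm.
(* Adding [L] keeps the residue and ensures positivity, since [x] may be 0 when [L = 1]. Then [t] is
   the part of [m] built from the primes not dividing [y]. *)
pose y := (x + L)%N; have y0 : (0 < y)%N by rewrite addn_gt0 L0 orbT.
have cyL : coprime y L by rewrite -coprime_modl modnDr coprime_modl.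
pose t := (m`_(\pi(y)^'))%N.
have memt p : prime p -> (p %| m)%N -> (p %| t)%N = ~~ (p %| y)%N.
  move=> pp pm; have := primes_part (\pi(y)^') m.
  move/(congr1 (fun s => p \in s)); rewrite mem_filter !mem_primes !inE /=.
  by rewrite pp pm m0 part_gt0 /= mem_primes pp y0 andbT.
(* A prime factor of m divides exactly one of y and t, so y + L * t is prime to m. *)
exists (y + L * t)%N; last by rewrite addnC mulnC modnMDl modnDr.
apply: contraT => ncop.
have /pdivP[p pp] : (1 < gcdn (y + L * t) m)%N.
  by rewrite ltn_neqAle eq_sym ncop gcdn_gt0 m0 orbT.
rewrite dvdn_gcd => /andP[pu pm]; case: (boolP (p %| y)%N) => py.
  move: pu; rewrite dvdn_addr // Euclid_dvdM // memt // py orbF => pL.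
  have : (p %| gcdn y L)%N by rewrite dvdn_gcd py.
  by rewrite (eqP cyL) dvdn1 => /eqP p1; rewrite p1 in pp.
by move: pu; rewrite dvdn_addl ?(negPf py) // dvdn_mull // memt.
Qed.

Lemma coprime_modinv (n x : nat) : (0 < n)%N -> coprime x n ->
  exists2 v, coprime v n & (x * v)%N = 1%N %[mod n].
Proof.
move=> n0 cxn; exists (x ^ (totient n).-1)%N; first exact: coprimeXl.
by rewrite -expnS prednK ?totient_gt0 // Euler_exp_totient.
Qed.

Definition unit_fiber (m L x : nat) : {set 'I_m} :=
  [set k : 'I_m | coprime k m && (k == x %[mod L])].

(* Multiplication by a unit u modulo m with u = y / x modulo L maps the fiber
   over x injectively into the fiber over y. *)
Lemma card_unit_fiber_le (m L x y : nat) :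
  (0 < m)%N -> (L %| m)%N -> coprime x L -> coprime y L ->
  (#|unit_fiber m L x| <= #|unit_fiber m L y|)%N.
Proof.
move=> m0 Lm cx cy; have L0 := dvdn_gt0 m0 Lm.
have [v cv xv] := coprime_modinv _ _ L0 cx.
have [u cu uE] : exists2 u, coprime u m & u = (y * v)%N %[mod L].
  by apply: coprime_lift => //; rewrite coprimeMl cy.
have [w cw uw] := coprime_modinv _ _ m0 cu.
pose f (k : 'I_m) := Ordinal (ltn_pmod (k * u) m0).
have finj : injective f.
  move=> j k /(congr1 val) /= /(congr1 (fun a => (a * w) %% m)%N).
  rewrite !modnMml -!mulnA -!(modnMmr _ (u * w)) uw !modnMmr !muln1 !modn_small //.
  by move/val_inj.
rewrite -(card_imset _ finj); apply: subset_leq_card; apply/subsetP => k'.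
case/imsetP => k; rewrite !inE => /andP[ck /eqP kx] ->.
rewrite coprime_modl coprimeMl ck cu modn_dvdm //=.
by rewrite -modnMm kx uE modnMm mulnCA -modnMmr xv modnMmr muln1.
Qed.

(** Sorting the units modulo [m] by their residue modulo [L] gives one fiber per unit [x] satisfying
    [P]. Comparing fibers in both directions shows that each is as large as the fiber over 1. *)
Lemma card_coprime_mod (m L : nat) (P : pred nat) : (0 < m)%N -> (L %| m)%N ->
  (forall k, P (k %% L)%N = P k) ->
  (#|[set k : 'I_m | coprime k m && P k]| =
   #|[set x : 'I_L | coprime x L && P x]| * #|unit_fiber m L 1|)%N.
Proof.
move=> m0 Lm PL; have L0 := dvdn_gt0 m0 Lm.
rewrite -sum1_card -[X in (X * _)%N]sum1_card big_distrl /=.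
rewrite (partition_big (fun k : 'I_m => Ordinal (ltn_pmod k L0))
  (fun x : 'I_L => x \in [set x : 'I_L | coprime x L && P x])) /=; last first.
  move=> k; rewrite !inE /= PL coprime_modl => /andP[ck ->].
  by rewrite (coprime_dvdr Lm ck).
apply: eq_bigr => x; rewrite inE mul1n => /andP[cx Px].
rewrite sum1dep_card.
have -> : #|unit_fiber m L 1| = #|unit_fiber m L x|.
  by apply/eqP; rewrite eqn_leq !card_unit_fiber_le // coprime1n.
apply: eq_card => k; rewrite !inE -val_eqE /= [(x %% L)%N]modn_small //.
case: eqVneq => [kx|]; rewrite ?andbF //= !andbT.
by rewrite -PL kx Px andbT.
Qed.

Lemma card_coprime (n : nat) : #|[set k : 'I_n | coprime k n]| = totient n.
Proof.
rewrite totient_count_coprime big_mkord -sum1dep_card big_mkcond.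
by apply: eq_bigr => k _; rewrite coprime_sym; case: coprime.
Qed.

(** The trivial predicate identifies the fiber size as the quotient of the totients;
    cross-multiplying avoids division in [nat]. *)
Lemma card_coprime_mod_totient (m L : nat) (P : pred nat) :
  (0 < m)%N -> (L %| m)%N -> (forall k, P (k %% L)%N = P k) ->
  (#|[set k : 'I_m | coprime k m && P k]| * totient L =
   totient m * #|[set x : 'I_L | coprime x L && P x]|)%N.
Proof.
move=> m0 Lm PL; rewrite (card_coprime_mod _ _ _ m0 Lm PL).
have := card_coprime_mod _ _ predT m0 Lm (fun=> erefl).
have E n : [set k : 'I_n | coprime k n && predT (k : nat)] =
           [set k : 'I_n | coprime k n].
  by apply/setP => k; rewrite !inE andbT.
by rewrite !E !card_coprime => ->; rewrite [RHS]mulnC -!mulnA (mulnC (totient L)).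
Qed.

Lemma sum_nat_shift_periodic (V : nmodType) (n : nat) (F : nat -> V) :
  (0 < n)%N -> F n = F 0%N -> \sum_(1 <= k < n.+1) F k = \sum_(k < n) F k.
Proof.
by move=> n0 Fn; rewrite big_nat_recr //= Fn -(big_mkord predT) (big_ltn n0) addrC.
Qed.

(** * Polynomial congruences and the counting function eta *)

(** Over the integers, [p - p.[b]%:P] has the factor ['X - b%:P]; evaluate at [a]. *)
Lemma dvdz_horner_sub (p : {poly int}) (a b : int) : (a - b %| p.[a] - p.[b])%Z.
Proof.
have /factor_theorem[q qE] : root (p - p.[b]%:P) b.
  by rewrite /root !hornerE subrr.
have := congr1 (fun s => s.[a]) qE; rewrite !hornerE => ->.
exact: dvdz_mull.
Qed.

Lemma dvdz_horner_modn (p : {poly int}) (d L k : nat) : (d %| L)%N ->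
  (d%:Z %| p.[(k %% L)%N%:Z])%Z = (d%:Z %| p.[k%:Z])%Z.
Proof.
move=> dL; rewrite -[in RHS](subrK p.[(k %% L)%N%:Z] p.[k%:Z]) rpredDl //.
apply: dvdz_trans (dvdz_horner_sub _ _ _).
apply: (dvdz_trans (dL : (d%:Z %| L%:Z)%Z)).
by rewrite {1}(divn_eq k L) PoszD addrK PoszM dvdz_mull.
Qed.

Lemma lcm_family_gt0 (r : nat) (d : 'I_r -> nat) :
  (forall i, 0 < d i)%N -> (0 < lcm_family d)%N.
Proof.
by move=> d0; rewrite /lcm_family; elim/big_ind: _ => // a b; rewrite lcmn_gt0 => -> ->.
Qed.

Lemma dvdn_lcm_family (r : nat) (d : 'I_r -> nat) (i : 'I_r) :
  (d i %| lcm_family d)%N.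
Proof. exact: (biglcmn_sup i). Qed.

Lemma coprime_lcm_family (r : nat) (d : 'I_r -> nat) (x : nat) :
  coprime x (lcm_family d) = [forall i, coprime x (d i)].
Proof.
apply/idP/forallP => [cx i|cx]; first exact: coprime_dvdr (dvdn_lcm_family _ _ _) cx.
rewrite /lcm_family; elim/big_ind: _ => [|a b ca cb|i _]; rewrite ?coprimen1 //.
apply: (@coprime_dvdr _ (a * b)); last by rewrite coprimeMr ca.
by rewrite dvdn_lcm dvdn_mulr ?dvdn_mull.
Qed.

Lemma eta_eq_card (r : nat) (g : 'I_r -> {poly int}) (d : 'I_r -> nat) :
  eta g d = #|[set x : 'I_(lcm_family d) | coprime x (lcm_family d) &&
                 [forall i, ((d i)%:Z %| (g i).[x%:Z])%Z]]|.
Proof.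
apply: eq_card => x; rewrite !inE coprime_lcm_family.
apply/forallP/andP => [H|[/forallP H1 /forallP H2] i]; last by rewrite H1 H2.
by split; apply/forallP => i; case/andP: (H i).
Qed.

Lemma sum_coprime_eta (m r : nat) (g : 'I_r -> {poly int}) (d : 'I_r -> nat) :
  (0 < m)%N -> (lcm_family d %| m)%N ->
  ((\sum_(1 <= k < m.+1 | coprime k m)
      [forall i, ((d i)%:Z %| (g i).[k%:Z])%Z]) * totient (lcm_family d) =
   totient m * eta g d)%N.
Proof.
move=> m0 Lm; pose P k := [forall i, ((d i)%:Z %| (g i).[k%:Z])%Z].
have PE n k : (forall i, d i %| n)%N -> P (k %% n)%N = P k.
  by move=> dn; apply: eq_forallb => i; rewrite dvdz_horner_modn.
have dm i : (d i %| m)%N := dvdn_trans (dvdn_lcm_family _ _ _) Lm.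
rewrite eta_eq_card -(card_coprime_mod_totient _ _ P) //; last first.
  by move=> k; apply: (PE) => i; apply: dvdn_lcm_family.
congr (_ * _)%N; rewrite -sum1dep_card big_mkcond.
(* The sum runs over 1, ..., m and the ordinals over 0, ..., m - 1: the summand at [m] must agree
   with the one at 0, as both conditions depend only on the residue modulo [m]. *)
rewrite (@sum_nat_shift_periodic nat) //=; last first.
  rewrite -(coprime_modl m) modnn; congr (if _ then nat_of_bool _ else _).
  by rewrite -/(P m) -/(P 0%N) -(PE m m dm) modnn.
rewrite [RHS]big_mkcond; apply: eq_bigr => k _; rewrite -/(P k).
by case: coprime => //=; case: (P k).
Qed.

(** * Roots of unity and the divisor formula for Ramanujan sums *)

Definition cis (R : realType) (x : R) : R[i] := (cos x +i* sin x)%C.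

Lemma cis0 (R : realType) : cis R 0 = 1.
Proof. by rewrite /cis cos0 sin0. Qed.

Lemma cisD (R : realType) (x y : R) : cis R (x + y) = cis R x * cis R y.
Proof. by rewrite /cis cosD sinD; simpc; congr (_ +i* _)%C; ring. Qed.

Lemma cisMn (R : realType) (x : R) (n : nat) : cis R (x *+ n) = cis R x ^+ n.
Proof. by elim: n => [|n IH]; rewrite ?cis0 // mulrS exprS cisD IH. Qed.

Lemma cis_2pi_int (R : realType) (k : int) : cis R (2 * pi * k%:~R) = 1.
Proof.
have nat_case n : cis R (2 * pi * n%:R) = 1.
  by rewrite mulr_natr cisMn mulr_natl /cis cos2pi -[pi *+ 2]add0r sinD2pi sin0 expr1n.
case: k => n; first exact: nat_case.
have := cisD R (2 * pi * (Negz n)%:~R) (2 * pi * n.+1%:R).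
by rewrite nat_case mulr1 -mulrDr NegzE rmorphN /= addNr mulr0 cis0 => <-.
Qed.

(** Removing full turns leaves the angle [2 * y] with [y = pi * s / n] and [s < n]. If [s > 0] then
    [sin y > 0], so the cosine of [2 * y] is below 1. *)
Lemma cis_eq1 (R : realType) (n : nat) (k : int) : (0 < n)%N ->
  (cis R (2 * pi * k%:~R / n%:R) == 1) = (n%:Z %| k)%Z.
Proof.
move=> n0; have n0' : n%:R != 0 :> R by rewrite pnatr_eq0 -lt0n.
apply/idP/idP => [|/dvdzP[q ->]]; last first.
  by rewrite rmorphM /= -!mulrA mulfV // mulr1 mulrA cis_2pi_int.
rewrite {1}(divz_eq k n) rmorphD rmorphM /= mulrDr mulrDl cisD.
rewrite [2 * pi * (_ * _)]mulrA mulfK // cis_2pi_int mul1r.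
have nz : n%:Z != 0 by rewrite -lt0n in n0 *; lia.
move=> c1; apply/dvdz_mod0P; move: c1.
have := modz_ge0 k nz; have := ltz_pmod k (n0 : 0 < n%:Z).
case: (k %% n)%Z => // s; rewrite ltz_nat => sn _.
case: (posnP s) => [->//|s0] /eqP[+ _].
pose y : R := pi * s%:R / n%:R.
have -> : 2 * pi * s%:R / n%:R = y *+ 2 by rewrite /y -[RHS]mulr_natl !mulrA.
rewrite cos_mulr2n => c1.
have : 0 < sin y.
  apply: sin_gt0_pi; rewrite /y divr_gt0 ?mulr_gt0 ?pi_gt0 ?ltr0n //=.
  by rewrite ltr_pdivrMr ?ltr0n // ltr_pM2l ?pi_gt0 // ltr_nat.
have := cos2Dsin2 y => cs s_gt0.
have : sin y ^+ 2 > 0 by rewrite exprn_gt0.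
by move=> ?; exfalso; lra.
Qed.

Lemma cexp_2pi (R : realType) (n j : nat) (k : int) :
  cexp (2 * (pi : R)%:C%C * 'i%C * j%:R * k%:~R / n%:R) =
  cis R (2 * pi * k%:~R / n%:R) ^+ j.
Proof.
have -> : 2 * (pi : R)%:C%C * 'i%C * j%:R * k%:~R / n%:R =
          ((2 * pi * k%:~R / n%:R) *+ j)%:C%C * 'i%C :> R[i].
  rewrite -(mulr_natl (2 * pi * _ / _)) !rmorphM /= fmorphV rmorph_int.
  by rewrite !rmorph_nat; ring.
by rewrite -cisMn /cexp /cis; simpc; rewrite /= expR0 !mul1r.
Qed.

(** A geometric sum: with [z ^+ n = 1], its product with [z - 1] is 0, so it vanishes unless
    [z = 1], which [cis_eq1] decides. *)
Lemma sum_cis (R : realType) (n : nat) (k : int) : (0 < n)%N ->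
  \sum_(1 <= j < n.+1) cis R (2 * pi * k%:~R / n%:R) ^+ j =
  if (n%:Z %| k)%Z then n%:R else 0.
Proof.
move=> n0; have n0' : n%:R != 0 :> R by rewrite pnatr_eq0 -lt0n.
set z := cis R _.
have zn : z ^+ n = 1 by rewrite /z -cisMn -(mulr_natr (_ / _)) divfK // cis_2pi_int.
rewrite (sum_nat_shift_periodic _ _ (fun j => z ^+ j)) ?zn ?expr0 //.
have := subrX1 z n; rewrite zn subrr => /esym/eqP; rewrite mulf_eq0 subr_eq0.
rewrite /z cis_eq1 // -/z; case: ifPn => [|_ /= /eqP //].
rewrite -(cis_eq1 R n) // -/z => /eqP -> _.
by under eq_bigr do rewrite expr1n; rewrite sumr_const card_ord.
Qed.

Lemma ramanujan_sum_divisors (R : realType) (n : nat) (k : int) : (0 < n)%N ->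
  ramanujan_sum R n k =
  \sum_(d <- divisors n) d%:R * (mobius (n %/ d))%:~R * (d%:Z %| k)%Z%:R.
Proof.
move=> n0; rewrite /ramanujan_sum; under eq_bigr do rewrite cexp_2pi.
(* Exchanging each divisor with its complement makes the inner sum run over 1, ..., d, with terms
   the powers of the root raised to [n %/ d]. *)
rewrite sum_coprime_mobius // (@big_divisors_compl _ _ predT) //.
apply: eq_big_seq => d; rewrite -dvdn_divisors // => dn.
have d0 := dvdn_gt0 n0 dn.
have nd0 : (0 < n %/ d)%N by rewrite divn_gt0 // dvdn_leq.
rewrite divn_compl //.
rewrite [RHS]mulrAC [RHS]mulrC; congr (_ * _).
under eq_bigr => j _.
  rewrite exprM -cisMn.
  have -> : (2 * pi * k%:~R / n%:R) *+ (n %/ d) = 2 * pi * k%:~R / d%:R :> R.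
    rewrite -{1}(divnK dn) natrM -[LHS]mulr_natr; field.
    by rewrite !pnatr_eq0 -!lt0n d0 nd0.
  over.
by rewrite sum_cis //; case: ifP; rewrite ?mulr1 ?mulr0.
Qed.

(* d_i | m_i and m_i > 0 force d_i <= lcm(m_1, ..., m_r), so the tuples
   (d_1, ..., d_r) are functions into 'I_(lcm_family m).+1. *)
Theorem theorem2 (R : realType) (r : nat) (g : 'I_r -> {poly int})
    (m : 'I_r -> nat) (hr : (0 < r)%N) (hm : forall i, (0 < m i)%N) :
  R_G R g m =
  (totient (lcm_family m))%:R *
  \sum_(d : {ffun 'I_r -> 'I_(lcm_family m).+1} | [forall i, d i %| m i]%N)
     ((\prod_(i < r) ((d i)%:R * (mobius (m i %/ d i))%:~R)) /
        (totient (lcm_family (fun i => d i : nat)))%:R *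
      (eta g (fun i => d i : nat))%:R) :> R[i].
Proof.
set M := lcm_family m; have M0 : (0 < M)%N by apply: lcm_family_gt0.
have mM i : (0 < m i <= M)%N by rewrite hm dvdn_leq // dvdn_lcm_family.
pose w (d : {ffun 'I_r -> 'I_M.+1}) : R[i] :=
  \prod_(i < r) ((d i)%:R * (mobius (m i %/ d i))%:~R).
pose c (d : {ffun 'I_r -> 'I_M.+1}) (k : nat) : bool :=
  [forall i, ((d i)%:Z %| (g i).[k%:Z])%Z].
(* Choosing one divisor in each factor gives a tuple [d]; the product of the divisibility indicators
   is the indicator [c d k] of their conjunction. *)
have expand k : \prod_(i < r) ramanujan_sum R (m i) (g i).[k%:Z] =
    \sum_(d : {ffun 'I_r -> 'I_M.+1} | [forall i, d i %| m i]%N) w d * (c d k)%:R.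
  under eq_bigr => i _.
    rewrite ramanujan_sum_divisors // (@big_divisors_ord _ _ M predT) //.
    under eq_bigl do rewrite andbT.
    over.
  rewrite (bigA_distr_big_dep (fun i (d : 'I_M.+1) => (d %| m i)%N)).
  apply: eq_big => [d|d _]; first by apply/familyP/forallP.
  rewrite big_split -/(w d) /=; congr (_ * _).
  rewrite /c; case: (boolP [forall i, _]) => [/forallP H|].
    by rewrite big1 // => i _; rewrite H.
  by case/forallPn => i /negPf H; rewrite (bigD1 i) //= H mul0r.
rewrite /R_G -/M; under eq_bigr do rewrite expand.
rewrite exchange_big mulr_sumr; apply: eq_bigr => d /forallP dm.
rewrite -mulr_sumr -natr_sum -/(w d).
set L := lcm_family _.
have LM : (L %| M)%N.
  apply/dvdn_biglcmP => i _; apply: dvdn_trans (dm i) (dvdn_lcm_family _ _ _).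
(* The count of units is known only after multiplication by [totient L]; being nonzero, this factor
   can be cancelled. *)
have L0 : (totient L)%:R != 0 :> R[i].
  by rewrite pnatr_eq0 -lt0n totient_gt0 (dvdn_gt0 M0 LM).
have := sum_coprime_eta M r g (fun i => d i : nat) M0 LM.
rewrite -/L => /(congr1 (fun n => n%:R : R[i])); rewrite !natrM => E.
rewrite mulrCA -!mulrA; congr (w d * _).
by apply: (mulIf L0); rewrite E; field.
Qed.
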